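(* Let ${\mathcal G}=(B\cup W,E)$ be a finite bipartite graph embedded in the plane with vertex multiplicities $\mathbf n$, a choice of cilia and a connection $\Phi$. Suppose given, for each vertex $v$, a weighted bipartite graph (gadget) $\Gamma_v$ with an ordered list of distinguished boundary vertices, and a real matrix $M_v$, as follows. (i) For a white vertex $w$ with neighbors $b_1,\dots,b_d$ in edge order at $w$: $\Gamma_w$ has $dn_w$ boundary vertices, split into consecutive blocks of size $n_w$, the $i$-th block associated to the edge $b_iw$; $M_w=[M_{b_1w}\,|\cdots|\,M_{b_dw}]$ is an $n_w\times dn_w$ matrix with $n_w\times n_w$ blocks. (ii) For a black vertex $b$ with neighbors $w_1,\dots,w_k$ in edge order at $b$: $\Gamma_b$ has $N_b=\sum_i n_{w_i}$ boundary vertices, split into consecutive blocks, the $i$-th of size $n_{w_i}$ and associated to the edge $bw_i$; $M_b$ is the $N_b\times n_b$ matrix whose $i$-th block of rows is an $n_{w_i}\times n_b$ matrix $\phi'_{bw_i}$, and $\phi_{bw}=M_{bw}\,\phi'_{bw}$ for every edge $bw$. (iii) For every black $b$ and every $n_b$-element set $I$ of boundary positions of $\Gamma_b$, the sum of weights of matchings of $\Gamma_b$ which cover every non-boundary vertex of $\Gamma_b$ exactly once and cover exactly the boundary vertices in $I$ equals the maximal minor $\Delta_I(M_b)$ (rows $I$ in increasing order); likewise for every white $w$ and $n_w$-element set $J$ of boundary positions of $\Gamma_w$, the corresponding sum equals $\Delta_J(M_w)$ (columns $J$ in increasing order). Let $\hat{\mathcal G}$ be the graph obtained from the disjoint union of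 the gadgets by joining, for every edge $bw$ of ${\mathcal G}$ and every $1\le i\le n_w$, the $i$-th vertex of the block of $\Gamma_b$ associated to $bw$ to the $i$-th vertex of the block of $\Gamma_w$ associated to $bw$ by a ''middle edge'' of weight $1$. For a dimer cover (perfect matching) $\pi$ of $\hat{\mathcal G}$, with weight $\mathrm{wt}(\pi)$ the product of its edge weights, let $m(\pi)_e$ be the number of middle edges over $e$ not used by $\pi$. Then for every $m\in\Omega_{\mathbf n}({\mathcal G})$, $$\sum_{\pi:\ m(\pi)=m}\mathrm{wt}(\pi)=\mathrm{Tr}_\Phi(m).$$
   Context: A vertex multiplicity is a function $\mathbf n:B\cup W\to\mathbb Z_{>0}$, $v\mapsto n_v$. An $\mathbf n$-multiweb is a function $m:E\to\mathbb Z_{\ge0}$ with $\sum_{u\sim v}m_{uv}=n_v$ for every vertex $v$; $\Omega_{\mathbf n}({\mathcal G})$ is the set of $\mathbf n$-multiwebs. A connection $\Phi=\{\phi_{bw}\}_{bw\in E}$ assigns to each edge $bw$ ($b$ black, $w$ white) a real $n_w\times n_b$ matrix $\phi_{bw}$. A choice of cilia assigns to each vertex $v$ a distinguished wedge between two cyclically consecutive incident edges; it determines a total order (''edge order'') of the edges at $v$: at a black vertex, counterclockwise starting just after the cilium; at a white vertex, clockwise starting just after the cilium. Trace. Let $\mathcal C_v=\{1,\dots,n_v\}$. A coloring of $m\in\Omega_{\mathbf n}({\mathcal G})$ assigns to each edge $e=bw$ with $m_e>0$ subsets $S_e\subset\mathcal C_b$, $T_e\subset\mathcal C_w$ of size $m_e$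 such that at each black $b$ the sets $S_{bw}$ partition $\mathcal C_b$ and at each white $w$ the sets $T_{bw}$ partition $\mathcal C_w$. The sign $c_b$ is the signature of the permutation of $\mathcal C_b$ obtained by listing the sets $S_{bw}$ in the edge order at $b$, each in increasing order; $c_w$ is defined likewise with the sets $T_{bw}$ in the edge order at $w$. Then $\mathrm{Tr}_\Phi(m)=\sum_C\prod_v c_v\prod_{e=bw:\,m_e>0}\det[(\phi_{bw})_{T_e,S_e}]$, summing over colorings $C$, where $(\phi)_{T,S}$ is the submatrix with rows $T$ and columns $S$ in increasing order. *)

(* Defs.v *)
From HB Require Import structures.
From mathcomp Require Import all_boot all_order all_algebra all_fingroup.
Set Implicit Arguments. Unset Strict Implicit. Unset Printing Implicit Defensive.
Import Order.TTheory GRing.Theory Num.Theory.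
Local Open Scope ring_scope.

(* The base graph G = (B u W, E) with vertex multiplicities and the    *)
(* edge orders at every vertex determined by the cilia.                *)
Record cgraph := CGraph {
  Bv : finType;
  Wv : finType;
  Ed : finType;
  eb : Ed -> Bv;
  ew : Ed -> Wv;
  nB : Bv -> nat;
  nW : Wv -> nat;
  ordB : Bv -> seq Ed;
  ordW : Wv -> seq Ed
}.

Definition cgraph_ok (G : cgraph) : Prop :=
  injective (fun e : Ed G => (eb e, ew e)) /\
  (forall b : Bv G, (0 < nB b)%N) /\ (forall w : Wv G, (0 < nW w)%N) /\
  (forall b : Bv G, uniq (ordB b) /\ forall e, (e \in ordB b) = (eb e == b)) /\
  (forall w : Wv G, uniq (ordW w) /\ forall e, (e \in ordW w) = (ew e == w)).

Definition multiweb (G : cgraph) (m : Ed G -> nat) : Prop :=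
  (forall b : Bv G, (\sum_(e | eb e == b) m e)%N = nB b) /\
  (forall w : Wv G, (\sum_(e | ew e == w) m e)%N = nW w).

Definition connection (R : Type) (G : cgraph) :=
  forall e : Ed G, 'M[R]_(nW (ew e), nB (eb e)).

Definition incr n (A : {set 'I_n}) : seq 'I_n :=
  sort (fun x y : 'I_n => (x <= y)%N) (enum A).

(* signature of the permutation of {0..n-1} listed by the sequence s
   (0 if s does not list a permutation) *)
Definition seq_sign (R : pzRingType) (n : nat) (s : seq nat) : R :=
  match [pick sg : 'S_n | [forall k : 'I_n, val (sg k) == nth 0%N s k]] with
  | Some sg => (-1) ^+ sg
  | None => 0
  end.

Definition minor (R : comPzRingType) p q (k : nat) (M : 'M[R]_(p, q))
    (T : {set 'I_p}) (S : {set 'I_q}) : R :=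
  \det (\matrix_(i < k, j < k)
          match onth (incr T) i, onth (incr S) j with
          | Some r, Some c => M r c
          | _, _ => 0
          end).

Definition colT (G : cgraph) :=
  {dffun forall e : Ed G, {set 'I_(nB (eb e))} * {set 'I_(nW (ew e))}}.

Definition coloring (G : cgraph) (m : Ed G -> nat) (C : colT G) : bool :=
  [forall e, (#|(C e).1| == m e) && (#|(C e).2| == m e)] &&
  [forall b : Bv G, forall c : 'I_(nB b),
      #|[set e | (eb e == b) && [exists x in (C e).1, val x == val c]]| == 1%N] &&
  [forall w : Wv G, forall c : 'I_(nW w),
      #|[set e | (ew e == w) && [exists x in (C e).2, val x == val c]]| == 1%N].

Definition signB (R : pzRingType) (G : cgraph) (C : colT G) (b : Bv G) : R :=
  seq_sign R (nB b) (flatten [seq [seq val x | x <- incr (C e).1] | e <- ordB b]).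
Definition signW (R : pzRingType) (G : cgraph) (C : colT G) (w : Wv G) : R :=
  seq_sign R (nW w) (flatten [seq [seq val x | x <- incr (C e).2] | e <- ordW w]).

Definition trace (R : comPzRingType) (G : cgraph) (phi : connection R G)
    (m : Ed G -> nat) : R :=
  \sum_(C : colT G | coloring m C)
     ((\prod_(b : Bv G) signB R C b) * (\prod_(w : Wv G) signW R C w) *
      \prod_(e : Ed G | (0 < m e)%N) minor (m e) (phi e) (C e).2 (C e).1).

Record gadget (R : Type) (N : nat) := Gadget {
  gV : finType;
  gE : finType;
  gsrc : gE -> gV;
  gtgt : gE -> gV;
  gwt : gE -> R;
  gcol : gV -> bool;
  gbd : 'I_N -> gV
}.

Definition gadget_ok R N (g : gadget R N) : Prop :=
  (forall f : gE g, gcol (gsrc f) != gcol (gtgt f)) /\ injective (gbd g).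

Definition ginc R N (g : gadget R N) (f : gE g) (x : gV g) : bool :=
  (gsrc f == x) || (gtgt f == x).

Definition bmatching R N (g : gadget R N) (I : {set 'I_N}) (mu : {set gE g}) : bool :=
  [forall x : gV g, #|[set f in mu | ginc f x]| ==
     (if [exists i, gbd g i == x]
      then (if [exists i in I, gbd g i == x] then 1 else 0)
      else 1)%N].

Definition bsum (R : comPzRingType) N (g : gadget R N) (I : {set 'I_N}) : R :=
  \sum_(mu : {set gE g} | bmatching I mu) \prod_(f in mu) gwt f.

Definition NB (G : cgraph) (b : Bv G) : nat := (\sum_(e <- ordB b) nW (ew e))%N.
Definition NW (G : cgraph) (w : Wv G) : nat := (size (ordW w) * nW w)%N.

Definition offset (T : eqType) (sz : T -> nat) (s : seq T) (e : T) : nat :=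
  (\sum_(e' <- take (index e s) s) sz e')%N.
Definition offB (G : cgraph) (e : Ed G) : nat :=
  offset (fun e' => nW (ew e')) (ordB (eb e)) e.
Definition offW (G : cgraph) (e : Ed G) : nat :=
  offset (fun _ => nW (ew e)) (ordW (ew e)) e.

Definition blkW (R : pzRingType) (G : cgraph) (MW : forall w : Wv G, 'M[R]_(nW w, NW w))
    (e : Ed G) : 'M[R]_(nW (ew e), nW (ew e)) :=
  \matrix_(i, j) match (insub (offW e + j)%N : option 'I_(NW (ew e))) with
                 | Some q => MW (ew e) i q | None => 0 end.
Definition blkB (R : pzRingType) (G : cgraph) (MB : forall b : Bv G, 'M[R]_(NB b, nB b))
    (e : Ed G) : 'M[R]_(nW (ew e), nB (eb e)) :=
  \matrix_(i, j) match (insub (offB e + i)%N : option 'I_(NB (eb e))) with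
                 | Some p => MB (eb e) p j | None => 0 end.

Section Hat.
Variables (R : comPzRingType) (G : cgraph).
Variables (GB : forall b : Bv G, gadget R (NB b)) (GW : forall w : Wv G, gadget R (NW w)).

Definition hV : finType :=
  ({b : Bv G & gV (GB b)} + {w : Wv G & gV (GW w)})%type.
Definition hE : finType :=
  ({b : Bv G & gE (GB b)} + {w : Wv G & gE (GW w)}
   + {e : Ed G & 'I_(nW (ew e))})%type.

Definition hinc (f : hE) (x : hV) : bool :=
  match f with
  | inl (inl (existT b g)) =>
      (x == inl (existT (fun b => gV (GB b)) b (gsrc g))) ||
      (x == inl (existT (fun b => gV (GB b)) b (gtgt g)))
  | inl (inr (existT w g)) =>
      (x == inr (existT (fun w => gV (GW w)) w (gsrc g))) ||
      (x == inr (existT (fun w => gV (GW w)) w (gtgt g)))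
  | inr (existT e k) =>
      (match (insub (offB e + k)%N : option 'I_(NB (eb e))) with
       | Some p => x == inl (existT (fun b => gV (GB b)) (eb e) (gbd (GB (eb e)) p))
       | None => false end) ||
      (match (insub (offW e + k)%N : option 'I_(NW (ew e))) with
       | Some q => x == inr (existT (fun w => gV (GW w)) (ew e) (gbd (GW (ew e)) q))
       | None => false end)
  end.

Definition hwt (f : hE) : R :=
  match f with
  | inl (inl (existT b g)) => gwt g
  | inl (inr (existT w g)) => gwt g
  | inr _ => 1
  end.

Definition dimer (pi : {set hE}) : bool :=
  [forall x : hV, #|[set f in pi | hinc f x]| == 1%N].

Definition mpi (pi : {set hE}) (e : Ed G) : nat :=
  #|[set k : 'I_(nW (ew e)) |
       (inr (existT (fun e => 'I_(nW (ew e))) e k) : hE) \notin pi]|.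

Definition dimer_sum (m : Ed G -> nat) : R :=
  \sum_(pi : {set hE} | dimer pi && [forall e, mpi pi e == m e])
     \prod_(f in pi) hwt f.
End Hat.

(* Main.v *)
Require Import Defs.
From HB Require Import structures.
From mathcomp Require Import all_boot all_order all_algebra all_fingroup.
Set Implicit Arguments. Unset Strict Implicit. Unset Printing Implicit Defensive.
Import Order.TTheory GRing.Theory Num.Theory.
Local Open Scope ring_scope.

(** Cutting a dimer cover along the middle edges leaves a set [A e] of unused
    middle edges over each [e] and, in each gadget, a matching covering exactly
    the boundary positions in the [A e]. So the dimer sum is the sum over [A] of
    products of maximal minors of the [M_v]. The multi-block Laplace expansion
    of the minor at [v] along the edges at [v] yields the colorings at [v] with
    their signs [c_v], times one minor of [M_e] or [phi'_e] per edge; for a fixed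
    coloring, the sum over each [A e] is then the Cauchy-Binet formula for
    [phi_e = M_e phi'_e].

    Rows and columns are handled as lists of natural numbers and matrices as
    functions on [nat], so that no transport along [en e = v] is needed. *)

(** * Products of sums over dependent families *)

Lemma bigA_distr_dffun (R : comPzSemiRingType) (I : finType) (T : I -> finType)
    (Q : forall i, pred (T i)) (F : forall i, T i -> R) :
  \prod_i \sum_(t | Q i t) F i t =
  \sum_(f : {dffun forall i, T i} | [forall i, Q i (f i)]) \prod_i F i (f i).
Proof.
(* Extending [F] by 0 outside [Q] makes the sums unconditional; the predicate returns at the end as
   a vanishing factor. *)
pose P_ i := [ffun t : T i => if Q i t then F i t else 0].
transitivity (\prod_i \sum_(t : T i) P_ i t).
  apply: eq_bigr => i _; rewrite big_mkcond /=.
  by apply: eq_bigr => t _; rewrite ffunE.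
(* A dependent choice is encoded as a function into the tagged union whose value at [i] carries the
   tag [i]; distributivity for ordinary functions applies there. *)
have -> : \prod_i \sum_(t : T i) P_ i t =
    \sum_(g in family (tagged_with T)) \prod_i untag 0 (P_ i) (g i).
  rewrite -(bigA_distr_big_dep (fun i => [in tagged_with T i])
    (fun i => untag 0 (P_ i))).
  by apply: eq_bigr => i _; rewrite (big_tag (fun i => P_ i)).
rewrite -(big_fprod _ _ P_) (reindex (@fprod_of_dffun I T)) /=; last first.
  exact/onW_bij/fprod_of_dffun_bij.
rewrite [RHS]big_mkcond; apply: eq_bigr => f _.
have E i : fprod_of_dffun f i = f i.
  by rewrite -[f in RHS]fprod_of_dffunK /dffun_of_fprod ffunE.
case: forallP => [h|/forallP]; first by apply: eq_bigr => i _; rewrite ffunE E h.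
rewrite negb_forall => /existsP[i /negbTE hi].
by rewrite (bigD1 i) //= ffunE E hi mul0r.
Qed.

(** * Subsets of ['I_n] as increasing lists of naturals *)

Definition ranks n (A : {set 'I_n}) : seq nat := [seq val x | x <- incr A].

Lemma mem_incr n (A : {set 'I_n}) : incr A =i A.
Proof. by move=> x; rewrite mem_sort mem_enum. Qed.

Lemma size_incr n (A : {set 'I_n}) : size (incr A) = #|A|.
Proof. by rewrite size_sort -cardE. Qed.

Lemma size_ranks n (A : {set 'I_n}) : size (ranks A) = #|A|.
Proof. by rewrite size_map size_incr. Qed.

Lemma uniq_incr n (A : {set 'I_n}) : uniq (incr A).
Proof. by rewrite sort_uniq enum_uniq. Qed.

Lemma uniq_ranks n (A : {set 'I_n}) : uniq (ranks A).
Proof. by rewrite (map_inj_uniq val_inj) uniq_incr. Qed.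

Lemma sorted_ranks n (A : {set 'I_n}) : sorted ltn (ranks A).
Proof.
rewrite ltn_sorted_uniq_leq uniq_ranks sorted_map.
by apply: sort_sorted => x y; apply: leq_total.
Qed.

Lemma mem_ranks n (A : {set 'I_n}) i :
  (i \in ranks A) = [exists x in A, val x == i].
Proof.
apply/mapP/existsP => [[x xA ->]|[x /andP[xA /eqP <-]]].
  by exists x; rewrite -mem_incr xA /=.
by exists x; rewrite ?mem_incr.
Qed.

Lemma ranks_val n (A : {set 'I_n}) (x : 'I_n) : (val x \in ranks A) = (x \in A).
Proof. by rewrite (mem_map val_inj) mem_incr. Qed.

Lemma ranks_lt n (A : {set 'I_n}) i : i \in ranks A -> (i < n)%N.
Proof. by case/mapP => x _ ->; apply: ltn_ord. Qed.

Lemma ranks_unique n (A : {set 'I_n}) (s : seq nat) :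
  sorted ltn s -> s =i ranks A -> s = ranks A.
Proof.
by move=> ss e; apply: (irr_sorted_eq ltn_trans ltnn ss) => //; apply: sorted_ranks.
Qed.

Lemma ranksT n : ranks [set: 'I_n] = iota 0 n.
Proof.
apply/esym/ranks_unique; first exact: iota_ltn_sorted.
move=> i; rewrite mem_iota add0n; apply/idP/idP => [lt_i|/ranks_lt //].
by rewrite -[i]/(val (Ordinal lt_i)) ranks_val inE.
Qed.

(** * Minors on lists of indices and the Cauchy-Binet formula *)

Section Minors.
Variable R : comPzRingType.

Definition nat_minor (k : nat) (F : nat -> nat -> R) (r c : seq nat) : R :=
  \det (\matrix_(i < k, j < k) F (nth 0%N r i) (nth 0%N c j)).

(** Extension by zero keeps the product formula valid at all natural indices, in range or not. *)
Definition mxfun p q (M : 'M[R]_(p, q)) (i j : nat) : R :=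
  match (insub i : option 'I_p), (insub j : option 'I_q) with
  | Some x, Some y => M x y
  | _, _ => 0
  end.

Lemma mxfunE p q (M : 'M[R]_(p, q)) (i : 'I_p) (j : 'I_q) : mxfun M i j = M i j.
Proof. by rewrite /mxfun !valK. Qed.

Lemma minorE p q k (M : 'M[R]_(p, q)) (T : {set 'I_p}) (S : {set 'I_q}) :
  #|T| = k -> #|S| = k ->
  minor k M T S = nat_minor k (mxfun M) (ranks T) (ranks S).
Proof.
move=> cT cS; rewrite /minor; congr (\det _); apply/matrixP => i j; rewrite !mxE.
have := ltn_ord i; rewrite -{2}cT -size_incr; have := ltn_ord j.
rewrite -{2}cS -size_incr /ranks; case: (incr T) => // x0 s; case: (incr S) => // y0 t.
move=> lj li; rewrite (nth_map x0) // (nth_map y0) // mxfunE !onthE.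
by rewrite (nth_map x0) // (nth_map y0).
Qed.

Lemma nat_minor_tr k (F : nat -> nat -> R) r c :
  nat_minor k F r c = nat_minor k (fun i j => F j i) c r.
Proof. by rewrite /nat_minor -det_tr; congr (\det _); apply/matrixP => i j; rewrite !mxE. Qed.

Lemma det_row_perm n (s : 'S_n) (A : 'M[R]_n) :
  \det (row_perm s A) = (-1) ^+ s * \det A.
Proof. by rewrite row_permE det_mulmx det_perm. Qed.

Lemma det_col_perm n (s : 'S_n) (A : 'M[R]_n) :
  \det (col_perm s A) = (-1) ^+ s * \det A.
Proof. by rewrite col_permE det_mulmx det_perm odd_permV mulrC. Qed.

(** Multilinearity in the rows gives a sum over maps [t] from rows to summation indices. A
    non-injective [t] repeats a row and contributes 0. An injective one is the increasing
    enumeration of its image [A] after a permutation, and these permutations with their signs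
    assemble the first minor. *)
Lemma Cauchy_Binet k n (f g : nat -> nat -> R) :
  \det (\matrix_(i < k, j < k) \sum_(l < n) f i l * g l j) =
  \sum_(A : {set 'I_n} | #|A| == k)
     \det (\matrix_(i < k, j < k) f i (nth 0%N (ranks A) j)) *
     \det (\matrix_(i < k, j < k) g (nth 0%N (ranks A) i) j).
Proof.
pose X (t : {ffun 'I_k -> 'I_n}) :=
  (\prod_(i < k) f i (t i)) * \det (\matrix_(i < k, j < k) g (t i) j).
transitivity (\sum_t X t).
  rewrite /determinant; under eq_bigr => s _.
    under eq_bigr => i _ do rewrite mxE.
    rewrite bigA_distr_bigA big_distrr /=. over.
  rewrite exchange_big; apply: eq_bigr => t _; rewrite /X big_distrr /=.
  apply: eq_bigr => s _; rewrite big_split /= mulrCA; congr (_ * (_ * _)).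
  by apply: eq_bigr => i _; rewrite mxE.
rewrite (bigID (fun t : {ffun 'I_k -> 'I_n} => injectiveb t)) /= [X in _ + X]big1 ?addr0; last first.
  move=> t /injectivePn[i [j nij eqt]]; rewrite /X (determinant_alternate nij) ?mulr0 //.
  by move=> l; rewrite !mxE eqt.
rewrite (partition_big (fun t : {ffun 'I_k -> 'I_n} => [set t i | i : 'I_k])
   (fun A : {set 'I_n} => #|A| == k)) /=; last first.
  by move=> t /injectiveP it; rewrite card_imset // card_ord.
apply: eq_bigr => A /eqP cA.
have sA : size (incr A) == k by rewrite size_incr cA.
pose a := tnth (Tuple sA).
have aE i : val (a i) = nth 0%N (ranks A) i.
  rewrite /a /tnth /ranks /= (nth_map (tnth_default (Tuple sA) i)) //.
  by rewrite (eqP sA).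
have a_inj : injective a by apply/tuple_uniqP; exact: uniq_incr.
have aA i : a i \in A by rewrite -mem_incr mem_tnth.
pose h (s : 'S_k) := [ffun i => a (s i)].
have h_inj : injective h.
  move=> s1 s2 /ffunP e; apply/permP => i; apply: a_inj.
  by have := e i; rewrite !ffunE.
(* The injective maps with image [A] are exactly the [h s]: the permutation is read off from the
   position of [t i] in [incr A]. *)
have -> : \sum_(t : {ffun 'I_k -> 'I_n} | injectiveb t && ([set t i | i : 'I_k] == A)) X t =
          \sum_(t in h @: [set: 'S_k]) X t.
  apply: eq_bigl => t; apply/andP/imsetP => [[/injectiveP it /eqP eA]|[s _ ->]].
    have tA i : t i \in incr A by rewrite mem_incr -eA imset_f.
    have lt_i i : (index (t i) (incr A) < k)%N by rewrite -[ltnRHS](eqP sA) index_mem.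
    have s_inj : injective (fun i => Ordinal (lt_i i)).
      by move=> i j /(congr1 val) /= e; apply: it; rewrite -(nth_index (t i) (tA i)) e nth_index.
    exists (perm s_inj) => //; apply/ffunP => i; rewrite ffunE permE.
    apply: val_inj; rewrite aE /ranks /= (nth_map (t i)) ?index_mem //.
    by rewrite nth_index.
  have hi : injective (h s).
    by move=> i j; rewrite !ffunE => /a_inj /perm_inj.
  split; first exact/injectiveP.
  rewrite eqEcard card_imset // card_ord cA leqnn andbT.
  by apply/subsetP => _ /imsetP[i _ ->]; rewrite ffunE aA.
rewrite big_imset /=; last by move=> s1 s2 _ _; apply: h_inj.
rewrite [X in X * _]/determinant big_distrl /=; apply: eq_big => [s|s _]; first by rewrite inE.
rewrite /X -mulrA mulrCA; congr (_ * _).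
  by apply: eq_bigr => i _; rewrite mxE ffunE aE.
rewrite -det_row_perm; congr (\det _); apply/matrixP => i j.
by rewrite !mxE ffunE aE.
Qed.
End Minors.

Lemma mxfun_mulmx (R : comPzRingType) p n q (X : 'M[R]_(p, n)) (Y : 'M[R]_(n, q)) i j :
  mxfun (X *m Y) i j = \sum_(l < n) mxfun X i l * mxfun Y l j.
Proof.
rewrite {1}/mxfun; case: insubP => [x _ <-|ni]; last first.
  by rewrite big1 // => l _; rewrite /mxfun insubN // mul0r.
case: insubP => [y _ <-|nj]; last first.
  by rewrite big1 // => l _; rewrite [mxfun Y _ _]/mxfun valK insubN // mulr0.
by rewrite mxE; apply: eq_bigr => l _; rewrite !mxfunE.
Qed.

Lemma nat_minor_mulmx (R : comPzRingType) p n q (X : 'M[R]_(p, n)) (Y : 'M[R]_(n, q)) k r c :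
  nat_minor k (mxfun (X *m Y)) r c =
  \sum_(A : {set 'I_n} | #|A| == k)
     nat_minor k (mxfun X) r (ranks A) * nat_minor k (mxfun Y) (ranks A) c.
Proof.
rewrite -(Cauchy_Binet k n (fun i l => mxfun X (nth 0%N r i) l)
  (fun l j => mxfun Y l (nth 0%N c j))).
by congr (\det _); apply/matrixP => i j; rewrite !mxE mxfun_mulmx.
Qed.

Lemma mxfun_tr (R : comPzRingType) p q (M : 'M[R]_(p, q)) i j :
  mxfun M^T i j = mxfun M j i.
Proof. by rewrite /mxfun; case: insub => [x|]; case: insub => [y|] //; rewrite mxE. Qed.

Lemma minor_tr (R : comPzRingType) p q k (M : 'M[R]_(p, q)) (T : {set 'I_p}) (S : {set 'I_q}) :
  minor k M T S = minor k M^T S T.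
Proof.
rewrite /minor -det_tr; congr (\det _); apply/matrixP => i j; rewrite !mxE.
by case: onth => [x|]; case: onth => [y|] //; rewrite mxE.
Qed.

(** * Laplace expansion along several blocks *)

Section Laplace.
Variable R : comPzRingType.

(** Each permutation term of the determinant survives for exactly one [kappa], the one giving every
    column the block of the row matched with it. *)
Lemma det_split_columns (E : finType) n (blk : 'I_n -> E) (P : 'M[R]_n) :
  \det P = \sum_(kappa : {ffun 'I_n -> E})
             \det (\matrix_(k, l) if kappa l == blk k then P k l else 0).
Proof.
rewrite /determinant exchange_big; apply: eq_bigr => s _ /=.
rewrite -big_distrr /=; congr (_ * _).
rewrite (bigD1 [ffun l => blk ((s^-1)%g l)]) //= [X in _ + X]big1 ?addr0.
  by apply: eq_bigr => k _; rewrite mxE ffunE permK eqxx.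
move=> kappa /eqP neq.
have [k nk] : exists k, kappa (s k) != blk k.
  apply/existsP; rewrite -negb_forall; apply/negP => /forallP h; apply: neq.
  by apply/ffunP => l; rewrite ffunE -(eqP (h _)) permKV.
by rewrite (bigD1 k) //= mxE (negbTE nk) mul0r.
Qed.

Variable E : finType.

(** Entry [k] is the block of row [k]; [Some] leaves [None] free as the default of [nth], since [E]
    may be empty. *)
Definition blocks (m : E -> nat) (s : seq E) : seq (option E) :=
  flatten [seq nseq (m e) (Some e) | e <- s].

Lemma size_blocks m s : size (blocks m s) = (\sum_(e <- s) m e)%N.
Proof.
rewrite size_flatten /shape -map_comp sumnE big_map.
by apply: eq_bigr => e _ /=; rewrite size_nseq.
Qed.

Lemma mem_blocks m s o : o \in blocks m s -> o \in [seq Some e | e <- s].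
Proof. by case/flatten_mapP => e es /nseqP[-> _]; apply: map_f. Qed.

Lemma count_blocks m s e : uniq s -> e \in s -> count_mem (Some e) (blocks m s) = m e.
Proof.
move=> us es; rewrite count_flatten -map_comp sumnE big_map (bigD1_seq e) //=.
rewrite count_nseq /= eqxx mul1n big1 ?addn0 // => e' ne.
by rewrite count_nseq /= (inj_eq Some_inj) (negbTE ne).
Qed.

(** Induction on [s]: since [uniq s] keeps the first label out of the remaining blocks, peeling off
    the first block leaves zero off-diagonal blocks. *)
Lemma det_block_diagonal (F : nat -> nat -> R) (m : E -> nat) (ra ca : E -> seq nat) s n :
  uniq s -> n = (\sum_(e <- s) m e)%N ->
  {in s, forall e, size (ra e) = m e} -> {in s, forall e, size (ca e) = m e} ->
  \det (\matrix_(k < n, l < n)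
          if nth None (blocks m s) l == nth None (blocks m s) k
          then F (nth 0%N (flatten (map ra s)) k) (nth 0%N (flatten (map ca s)) l)
          else 0) =
  \prod_(e <- s) nat_minor (m e) F (ra e) (ca e).
Proof.
elim: s n => [|e s IH] n /=.
  by move=> _ ->; rewrite !big_nil => _ _; rewrite det_mx00.
case/andP=> nes us; rewrite !big_cons => -> hra hca.
have hs e' : e' \in s -> e' \in e :: s by rewrite inE orbC => ->.
rewrite -(IH _ us erefl); try by move=> e' /hs; auto.
set n' := (\sum_(_ <- _) _)%N.
set M := \matrix_(k, l) _; set M' := (X in _ = _ * \det X).
have nthb (k : 'I_(m e)) : nth None (nseq (m e) (Some e) ++ blocks m s) k = Some e.
  by rewrite nth_cat size_nseq ltn_ord nth_nseq ltn_ord.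
have nthc (k : nat) : nth None (nseq (m e) (Some e) ++ blocks m s) (m e + k) = nth None (blocks m s) k.
  by rewrite nth_cat size_nseq ltnNge leq_addr /= addKn.
have nne (k : 'I_n') : (nth None (blocks m s) k == Some e) = false.
  apply/negP => /eqP eq; have := @mem_nth _ None (blocks m s) k.
  rewrite size_blocks ltn_ord eq => /(_ isT) /mem_blocks.
  by rewrite (mem_map Some_inj) (negbTE nes).
have -> : M = block_mx (\matrix_(k < m e, l < m e) F (nth 0%N (ra e) k) (nth 0%N (ca e) l)) 0 0 M'.
  apply/matrixP => i j; rewrite -[i]splitK -[j]splitK /M /M' /blocks /= -/(blocks m s).
  have sra := hra e (mem_head _ _); have sca := hca e (mem_head _ _).
  case: (split i) => i'; case: (split j) => j' /=.
  - rewrite block_mxEul !mxE /= !nthb eqxx.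
    by rewrite !nth_cat sra sca !ltn_ord.
  - by rewrite block_mxEur !mxE /= nthc nthb nne.
  - by rewrite block_mxEdl !mxE /= nthc nthb eq_sym nne.
  - rewrite block_mxEdr !mxE /= !nthc; congr (if _ then F _ _ else _).
      by rewrite nth_cat sra ltnNge leq_addr /= addKn.
    by rewrite nth_cat sca ltnNge leq_addr /= addKn.
by rewrite det_ublock.
Qed.

Definition color_class n (kappa : {ffun 'I_n -> option E}) (e : E) : {set 'I_n} :=
  [set c | kappa c == Some e].

Definition has_profile (m : E -> nat) (s : seq E) n (kappa : {ffun 'I_n -> option E}) :=
  [forall c, kappa c \in [seq Some e | e <- s]] &&
  all (fun e => #|color_class kappa e| == m e) s.

(** A nonzero permutation term needs a label-preserving bijection from rows to columns, and such a
    bijection forces the label counts of the columns to be those of [blocks m s]. *)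
Lemma det_unprofiled (m : E -> nat) s n (kappa : {ffun 'I_n -> option E}) (P : 'M[R]_n) :
  uniq s -> n = (\sum_(e <- s) m e)%N -> ~~ has_profile m s kappa ->
  \det (\matrix_(k < n, l < n)
     if kappa l == nth None (blocks m s) k then P k l else 0) = 0.
Proof.
move=> us en npr; rewrite /determinant big1 // => sg _.
case: (boolP [forall k, kappa (sg k) == nth None (blocks m s) k]) => [/forallP hk|].
  case/negP: npr; apply/andP; split.
    apply/forallP => c; rewrite -[c](permKV sg) (eqP (hk _)).
    by apply: (@mem_blocks m); apply: mem_nth; rewrite size_blocks -en.
  apply/allP => e es; apply/eqP; rewrite -(count_blocks m us es).
  (* The multiplicity of [Some e] is the number of rows labelled [e], which [sg] carries onto the
     columns labelled [e]. *)
  rewrite -[blocks m s in RHS](mkseq_nth None) count_map size_blocks -en.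
  rewrite -val_enum_ord count_map -sum1_count big_enum_cond /= sum1dep_card.
  rewrite -[RHS](card_imset _ (@perm_inj _ sg)); apply: eq_card => c.
  apply/idP/imsetP => [|[k]].
    rewrite inE => hc; exists ((sg^-1)%g c); last by rewrite permKV.
    by rewrite inE -(eqP (hk _)) permKV.
  by rewrite !inE => hc ->; rewrite (eqP (hk _)).
rewrite negb_forall => /existsP[k nk].
by rewrite (bigD1 k) //= mxE (negbTE nk) mul0r mulr0.
Qed.

(** Both concatenations are cut at the same places, because the class of [e] has [m e] elements.
    Listing columns class by class thus puts the matrix in block diagonal form. *)
Lemma nth_color_classes (m : E -> nat) s n (kappa : {ffun 'I_n -> option E}) (k : nat) (x : 'I_n) :
  {in s, forall e, #|color_class kappa e| = m e} ->
  (k < \sum_(e <- s) m e)%N ->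
  nth 0%N (flatten [seq ranks (color_class kappa e) | e <- s]) k = val x ->
  nth None (blocks m s) k = kappa x.
Proof.
elim: s k => [|e s IH] k hm; first by rewrite big_nil.
have me := hm e (mem_head _ _).
rewrite big_cons /blocks /= !nth_cat size_ranks size_nseq me => lk.
case: ltnP => lke.
  move=> ex; rewrite nth_nseq lke; apply/esym/eqP.
  have : x \in color_class kappa e; last by rewrite inE.
  by rewrite -ranks_val /= -ex mem_nth // size_ranks me.
apply: IH; first by move=> e' hs; apply: hm; rewrite inE hs orbT.
by rewrite ltn_subLR.
Qed.

(** The list of columns, class after class, is a permutation; applying it to the columns makes the
    matrix block diagonal and costs its sign. *)
Lemma det_profiled (F : nat -> nat -> R) (m : E -> nat) (ra : E -> seq nat) s n
    (kappa : {ffun 'I_n -> option E}) :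
  uniq s -> n = (\sum_(e <- s) m e)%N ->
  {in s, forall e, size (ra e) = m e} -> has_profile m s kappa ->
  \det (\matrix_(k < n, l < n)
     if kappa l == nth None (blocks m s) k
     then F (nth 0%N (flatten (map ra s)) k) l else 0) =
  seq_sign R n (flatten [seq ranks (color_class kappa e) | e <- s]) *
  \prod_(e <- s) nat_minor (m e) F (ra e) (ranks (color_class kappa e)).
Proof.
move=> us en hra /andP[/forallP hcol /allP hm'].
have hm : {in s, forall e, #|color_class kappa e| = m e} by move=> e /hm' /eqP.
set t := (X in seq_sign _ _ X).
have szt : size t = n.
  rewrite size_flatten /shape -map_comp sumnE big_map [RHS]en !big_seq.
  by apply: eq_bigr => e es /=; rewrite size_ranks hm.
have tlt (k : 'I_n) : (nth 0%N t k < n)%N.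
  have : nth 0%N t k \in t by rewrite mem_nth // szt.
  by case/flatten_mapP => e es /ranks_lt.
have tcover (c : 'I_n) : val c \in t.
  have /mapP[e es ec] := hcol c; apply/flatten_mapP; exists e => //.
  by rewrite ranks_val inE ec.
have ut : uniq t.
  apply: (@leq_size_uniq _ (iota 0 n)); first exact: iota_uniq.
    by move=> i; rewrite mem_iota => /= li; apply: (tcover (Ordinal li)).
  by rewrite size_iota szt.
have t_inj : injective (fun k : 'I_n => Ordinal (tlt k)).
  move=> k l /(congr1 val) /= /eqP; rewrite nth_uniq ?szt // => /eqP.
  exact: val_inj.
(* The default 0 of [seq_sign] cannot occur: [t] lists every column once, so [perm t_inj] is
   available to be picked. *)
rewrite /seq_sign; case: pickP => [sg /forallP hsg|/(_ (perm t_inj)) /forallP[]]; last first.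
  by move=> k; rewrite permE.
rewrite -(@det_block_diagonal F m ra (fun e => ranks (color_class kappa e)) s n) //; last first.
  by move=> e es; rewrite size_ranks hm.
set M := (X in \det X = _); have -> : \det M = (-1) ^+ sg * \det (col_perm sg M).
  by rewrite det_col_perm mulrA -expr2 sqrr_sign mul1r.
congr (_ * \det _); apply/matrixP => k l; rewrite !mxE.
rewrite -(eqP (hsg l)) (@nth_color_classes m s n kappa l (sg l)) //; first by rewrite -en.
by rewrite (eqP (hsg l)).
Qed.

Lemma Laplace_multiblock (F : nat -> nat -> R) (m : E -> nat) (ra : E -> seq nat) s n :
  uniq s -> n = (\sum_(e <- s) m e)%N ->
  {in s, forall e, size (ra e) = m e} ->
  nat_minor n F (flatten (map ra s)) (iota 0 n) =
  \sum_(kappa : {ffun 'I_n -> option E} | has_profile m s kappa)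
    seq_sign R n (flatten [seq ranks (color_class kappa e) | e <- s]) *
    \prod_(e <- s) nat_minor (m e) F (ra e) (ranks (color_class kappa e)).
Proof.
move=> us en hra; rewrite /nat_minor.
rewrite (det_split_columns (fun k : 'I_n => nth None (blocks m s) k)).
rewrite (bigID (has_profile m s (n := n))) /= [X in _ + X]big1 ?addr0; last first.
  by move=> kappa; apply: det_unprofiled.
apply: eq_bigr => kappa pr; rewrite -(det_profiled F us en hra pr).
congr (\det _); apply/matrixP => k l; rewrite !mxE.
by rewrite nth_iota ?add0n.
Qed.
End Laplace.

(** * Blocks of boundary positions *)

Section Offsets.
Local Open Scope nat_scope.
Variables (T : eqType) (sz : T -> nat).
Implicit Type s : seq T.

Lemma offset_cons a s e :
  offset sz (a :: s) e = if a == e then 0 else sz a + offset sz s e.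
Proof. by rewrite /offset /=; case: eqP; rewrite ?big_nil ?big_cons. Qed.

Lemma offset_lt s e k :
  e \in s -> k < sz e -> offset sz s e + k < \sum_(e' <- s) sz e'.
Proof.
elim: s => //= a s IH; rewrite inE eq_sym offset_cons big_cons.
case: eqP => [-> _ lk|_ /= es lk]; first by rewrite add0n ltn_addr.
by rewrite -addnA ltn_add2l IH.
Qed.

Lemma offset_inj s e k e' k' :
  e \in s -> k < sz e -> e' \in s -> k' < sz e' ->
  offset sz s e + k = offset sz s e' + k' -> e = e' /\ k = k'.
Proof.
elim: s => //= a s IH; rewrite !inE !offset_cons ![_ == a]eq_sym.
case: (a =P e) => [<-|_]; case: (a =P e') => [<-|_] //=.
- by move=> _ lk es' lk'; rewrite -addnA => ek; move: lk; rewrite -[k]add0n ek ltnNge leq_addr.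
- by move=> es lk _ lk'; rewrite -addnA => ek; move: lk'; rewrite -[k']add0n -ek ltnNge leq_addr.
- by move=> es lk es' lk'; rewrite -!addnA => /addnI; apply: IH.
Qed.

Lemma offset_surj s p : uniq s -> p < \sum_(e <- s) sz e ->
  exists e k, [/\ e \in s, k < sz e & p = offset sz s e + k].
Proof.
elim: s p => [|a s IH] p /=; first by rewrite big_nil.
case/andP=> nas us; rewrite big_cons => lp.
have [lpa|lpa] := ltnP p (sz a).
  by exists a, p; rewrite mem_head offset_cons eqxx.
have [|e [k [es lk ep]]] := IH (p - sz a) us; first by rewrite ltn_subLR.
exists e, k; rewrite inE es orbT offset_cons; case: eqP => [ae|_].
  by move: nas; rewrite ae es.
by split=> //; rewrite -addnA -ep subnKC.
Qed.

(** Within a block the order is that of [r e]; across blocks it holds because the entries of [r e]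
    stay below [sz e]. *)
Lemma sorted_offsets s (r : T -> seq nat) : uniq s ->
  (forall e, sorted ltn (r e)) -> (forall e k, k \in r e -> k < sz e) ->
  sorted ltn (flatten [seq [seq offset sz s e + k | k <- r e] | e <- s]).
Proof.
move=> us sr ltr; rewrite sorted_pairwise; last exact: ltn_trans.
elim: s us => //= a s IH /andP[nas us].
have -> : [seq offset sz (a :: s) a + k | k <- r a] = r a.
  by rewrite offset_cons eqxx -[RHS]map_id; apply: eq_map => k.
have -> : [seq [seq offset sz (a :: s) e + k | k <- r e] | e <- s] =
    [seq [seq sz a + x | x <- [seq offset sz s e + k | k <- r e]] | e <- s].
  apply/eq_in_map => e es; rewrite -map_comp; apply: eq_map => k /=.
  by rewrite offset_cons addnA; case: eqP => // ae; rewrite ae es in nas.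
rewrite pairwise_cat -sorted_pairwise ?sr /=; last exact: ltn_trans.
apply/andP; split.
  apply/allrelP => x y xr /flatten_mapP[e es /mapP[z _ ->]].
  by rewrite /= ltn_addr // ltr.
rewrite (map_comp (map (addn (sz a)))) -map_flatten pairwise_map.
by apply: sub_pairwise (IH us) => x y /=; rewrite ltn_add2l.
Qed.
End Offsets.

(* One colour class of the vertices of the base graph: [en] maps an edge to its
   endpoint of that colour, and the boundary positions of the gadget at [v] are
   cut into blocks of sizes [sz e], one per edge [e] at [v], in the order [ord v]. *)
Section Side.
Variables (E V : finType) (en : E -> V) (n N : V -> nat) (ord : V -> seq E).
Variables (sz off : E -> nat).
Hypothesis ord_uniq : forall v, uniq (ord v).
Hypothesis mem_ord : forall v e, (e \in ord v) = (en e == v).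
Hypothesis NE : forall v, N v = (\sum_(e <- ord v) sz e)%N.
Hypothesis offE : forall e, off e = offset sz (ord (en e)) e.

(** The option has the same shape as the matches in [blkB], [blkW] and [hinc]; by [off_lt] below it
    is always [Some]. *)
Definition block_pos (e : E) (k : 'I_(sz e)) : option 'I_(N (en e)) :=
  insub (off e + k)%N.

Definition covered (A : forall e, {set 'I_(sz e)}) (v : V) : {set 'I_(N v)} :=
  [set p | [exists e, (en e == v) && [exists k in A e, val p == (off e + val k)%N]]].

Lemma off_lt e (k : 'I_(sz e)) : (off e + k < N (en e))%N.
Proof. by rewrite offE NE offset_lt // mem_ord. Qed.

Lemma off_inj e (k : 'I_(sz e)) e' (k' : 'I_(sz e')) : en e = en e' ->
  (off e + k = off e' + k')%N -> e = e' /\ val k = val k'.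
Proof.
move=> ee'; rewrite !offE -ee'.
by apply: offset_inj; rewrite ?mem_ord ?ee'.
Qed.

Lemma off_surj v (p : 'I_(N v)) :
  exists e (k : 'I_(sz e)), en e = v /\ val p = (off e + k)%N.
Proof.
have := ltn_ord p; rewrite [ltnRHS]NE => /(offset_surj (ord_uniq v)).
case=> e [k [es lk ep]]; exists e, (Ordinal lk); rewrite mem_ord in es.
by rewrite /= offE (eqP es) -ep.
Qed.

(** The blocks follow each other in the order [ord v], so increasing order of positions is
    concatenation along the edges. This is the row list that [Laplace_multiblock] takes. *)
Lemma ranks_covered A v :
  ranks (covered A v) =
  flatten [seq [seq (off e + k)%N | k <- ranks (A e)] | e <- ord v].
Proof.
apply/esym/ranks_unique.
  have -> : [seq [seq (off e + k)%N | k <- ranks (A e)] | e <- ord v] =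
      [seq [seq (offset sz (ord v) e + k)%N | k <- ranks (A e)] | e <- ord v].
    apply/eq_in_map => e; rewrite mem_ord => /eqP <-.
    by apply: eq_map => k; rewrite offE.
  apply: sorted_offsets => // [e|e k]; first exact: sorted_ranks.
  exact: ranks_lt.
move=> p; rewrite mem_ranks; apply/flatten_mapP/existsP.
  case=> e; rewrite mem_ord => /eqP ev /mapP[k kA ep].
  have := off_lt (Ordinal (ranks_lt kA)); rewrite ev -ep => lp.
  exists (Ordinal lp); rewrite inE /= eqxx andbT; apply/existsP; exists e.
  rewrite ev eqxx; apply/existsP; exists (Ordinal (ranks_lt kA)).
  by rewrite -ranks_val kA /= ep.
case=> x /andP[]; rewrite inE => /existsP[e /andP[ev /existsP[k /andP[kA /eqP ex]]]] /eqP <-.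
exists e; first by rewrite mem_ord.
by rewrite ex; apply: map_f; rewrite ranks_val.
Qed.

Lemma card_covered A v : #|covered A v| = (\sum_(e <- ord v) #|A e|)%N.
Proof.
rewrite -size_ranks ranks_covered size_flatten /shape -map_comp sumnE big_map.
by apply: eq_bigr => e _ /=; rewrite size_map size_ranks.
Qed.

Lemma sum_ord (m : E -> nat) v : (\sum_(e <- ord v) m e = \sum_(e | en e == v) m e)%N.
Proof.
rewrite -[RHS]big_filter; apply: perm_big; apply: uniq_perm => //.
  by rewrite filter_uniq // index_enum_uniq.
by move=> e; rewrite mem_ord mem_filter mem_index_enum andbT.
Qed.

Lemma prod_ord (R : comPzRingType) (X : E -> R) :
  \prod_v \prod_(e <- ord v) X e = \prod_e X e.
Proof.
rewrite (partition_big en predT) //=; apply: eq_bigr => v _.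
rewrite -[RHS]big_filter; apply: perm_big; apply: uniq_perm => //.
  by rewrite filter_uniq // index_enum_uniq.
by move=> e; rewrite mem_ord mem_filter mem_index_enum andbT.
Qed.

(** On the black side this is [blkB]; on the white side, applied to the transposed matrices, it is
    the transpose of [blkW]. *)
Definition row_block (R : pzRingType) (M : forall v, 'M[R]_(N v, n v)) (e : E) :
    'M[R]_(sz e, n (en e)) :=
  \matrix_(i, j) match block_pos i with Some p => M (en e) p j | None => 0 end.

Lemma mxfun_row_block (R : comPzRingType) (M : forall v, 'M[R]_(N v, n v)) e i j :
  (i < sz e)%N -> mxfun (row_block M e) i j = mxfun (M (en e)) (off e + i)%N j.
Proof.
move=> li; rewrite /mxfun (insubT (fun i => i < sz e)%N li) /=; case: (insub j) => [y|]; last by case: insub.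
by rewrite mxE.
Qed.

(** Multi-block Laplace along the edges at [v]: row [off e + i] of [M v] is row [i] of
    [row_block M e], so each block contributes a minor of its own matrix. *)
Lemma vertex_expansion (R : comPzRingType) (M : forall v, 'M[R]_(N v, n v))
    (m : E -> nat) (A : forall e, {set 'I_(sz e)}) v :
  (forall v, (\sum_(e | en e == v) m e)%N = n v) -> (forall e, #|A e| = m e) ->
  minor (n v) (M v) (covered A v) setT =
  \sum_(kappa : {ffun 'I_(n v) -> option E} | has_profile m (ord v) kappa)
    seq_sign R (n v) (flatten [seq ranks (color_class kappa e) | e <- ord v]) *
    \prod_(e <- ord v)
       nat_minor (m e) (mxfun (row_block M e)) (ranks (A e)) (ranks (color_class kappa e)).
Proof.
move=> hm cA.
have en_v : n v = (\sum_(e <- ord v) m e)%N by rewrite sum_ord hm.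
rewrite minorE ?cardsT ?card_ord //; last first.
  by rewrite card_covered en_v; apply: eq_bigr.
rewrite ranksT ranks_covered (@Laplace_multiblock _ _ _ m) //; last first.
  by move=> e _; rewrite size_map size_ranks.
apply: eq_bigr => kappa _; congr (_ * _); rewrite !big_seq.
apply: eq_bigr => e; rewrite mem_ord => /eqP ev; congr (\det _).
apply/matrixP => i j; rewrite !mxE.
have li : (i < size (ranks (A e)))%N by rewrite size_ranks cA.
rewrite (nth_map 0%N) // mxfun_row_block; first by rewrite ev.
by apply: (@ranks_lt _ (A e)); rewrite mem_nth.
Qed.

Definition middle_touches (R : Type) (g : forall v, gadget R (N v))
    (ek : {e : E & 'I_(sz e)}) (x : {v : V & gV (g v)}) : bool :=
  match block_pos (tagged ek) with
  | Some p => x == existT (fun v => gV (g v)) (en (tag ek)) (gbd (g (en (tag ek))) p)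
  | None => false
  end.

(* [d] stands for the number of matched gadget edges at [y]. *)
Lemma boundary_condition (R : Type) (g : forall v, gadget R (N v))
    (A : forall e, {set 'I_(sz e)}) v (y : gV (g v)) (d : nat) :
  injective (gbd (g v)) ->
  (d + #|[set ek : {e : E & 'I_(sz e)} | (tagged ek \notin A (tag ek)) &&
             middle_touches ek (existT _ v y)]| == 1)%N =
  (d == (if [exists i, gbd (g v) i == y]
         then (if [exists i in covered A v, gbd (g v) i == y] then 1 else 0)
         else 1))%N.
Proof.
(* A vertex off the boundary meets no middle edge, so [d] must be 1. At boundary position [p] a
   single middle edge arrives, and it is in use exactly when [p] is not covered. *)
move=> ginj; case: existsP => [[p /eqP py]|nex]; last first.
  rewrite (_ : [set _ | _] = set0) ?cards0 ?addn0 //.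
  apply/setP => -[e k]; rewrite !inE /middle_touches /=; apply/negbTE/negP.
  case/andP=> _; case: (block_pos k) => // p /eqP eq; case: nex.
  have ev : v = en e by have := congr1 tag eq.
  move: y eq {ginj}; rewrite ev => y /eqP; rewrite eq_Tagged /= => /eqP ->.
  by exists p.
have -> : [exists i in covered A v, gbd (g v) i == y] = (p \in covered A v).
  apply/existsP/idP => [[i /andP[iA]]|pA]; last by exists p; rewrite pA py eqxx.
  by rewrite -py => /eqP /ginj <-.
have [e [k [ev ep]]] := off_surj p.
(* The only middle edge ending at [y] is the [k]-th one over [e], by injectivity of the boundary map
   and of the offsets. *)
have tch e' (k' : 'I_(sz e')) :
    middle_touches (Tagged (fun e => 'I_(sz e)) k') (existT _ v y) =
    (Tagged (fun e => 'I_(sz e)) k' == Tagged (fun e => 'I_(sz e)) k).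
  rewrite /middle_touches /block_pos /=.
  rewrite (insubT (fun i => i < N (en e'))%N (off_lt k')) /=.
  apply/eqP/eqP => [eq|/(congr1 (fun u : {e : E & 'I_(sz e)} => (tag u, val (tagged u)))) /=].
    have ev' : v = en e' by have := congr1 tag eq.
    move: p y ginj py ep eq; rewrite ev' => p y ginj <- ep /eqP.
    rewrite eq_Tagged /= => /eqP /ginj /(congr1 val) /=.
    rewrite ep; case/off_inj => //; first by rewrite ev -ev'.
    move=> ee; move: k k' {ep}; rewrite ee => k k' /= /val_inj ->.
    by [].
  case=> ee; move: k' ; rewrite ee => k' /val_inj ->.
  move: p py ep {ginj}; move: y; rewrite -ev => y p <- ep; congr existT.
  by congr gbd; apply: val_inj.
have -> : (p \in covered A v) = (k \in A e).
  rewrite inE; apply/existsP/idP => [[e' /andP[/eqP ev' /existsP[k' /andP[kA']]]]|kA].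
    rewrite ep => /eqP /off_inj; case; first by rewrite ev ev'.
    by move=> ee; move: k' kA'; rewrite -ee => k' kA' /val_inj ->.
  by exists e; rewrite ev eqxx; apply/existsP; exists k; rewrite kA ep /=.
have -> : [set ek : {e : E & 'I_(sz e)} | (tagged ek \notin A (tag ek)) &&
             middle_touches ek (existT _ v y)] =
   if k \in A e then set0 else [set Tagged (fun e => 'I_(sz e)) k].
  apply/setP => ek; rewrite inE (_ : middle_touches ek _ = (ek == Tagged _ k)) 1?andbC; last by case: ek.
  case: eqP => /= [->|neq]; first by case: (k \in A e); rewrite ?inE ?eqxx.
  by case: (k \in A e); rewrite !inE //; apply/esym/eqP/neq.
case: (k \in A e); rewrite ?cards0 ?cards1 ?addn0 //.
by rewrite addn1 eqSS.
Qed.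
End Side.

(** * Cutting dimer covers along the middle edges *)

Lemma card_incident_tagged (R : Type) (V : finType) (N : V -> nat)
    (g : forall v, gadget R (N v)) (mu : forall v, {set gE (g v)}) v (y : gV (g v)) :
  #|[set f : {v : V & gE (g v)} | (tagged f \in mu (tag f)) &&
       ((existT (fun v => gV (g v)) v y ==
           existT (fun v => gV (g v)) (tag f) (gsrc (tagged f))) ||
        (existT (fun v => gV (g v)) v y ==
           existT (fun v => gV (g v)) (tag f) (gtgt (tagged f))))]| =
  #|[set f in mu v | ginc f y]|.
Proof.
have tag_inj : injective (fun f : gE (g v) => existT (fun v => gE (g v)) v f).
  by move=> f f' /eqP; rewrite eq_Tagged => /eqP.
rewrite -[RHS](card_imset _ tag_inj); apply: eq_card => -[v' f].
apply/idP/imsetP; rewrite inE /=.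
  case/andP=> fm ends; have ev : v' = v by case/orP: ends => /eqP /(congr1 tag).
  move: f fm ends; rewrite ev => f fm; rewrite !eq_Tagged /= => ends.
  by exists f; rewrite // inE fm /ginc ![_ == y]eq_sym.
(* Applying the whole membership condition to the equation between tagged pairs avoids inverting a
   dependent equality. *)
case=> f'; rewrite inE => /andP[fm ends] /(congr1 (fun u : {v : V & gE (g v)} =>
  (tagged u \in mu (tag u)) && ((existT (fun v => gV (g v)) v y ==
           existT (fun v => gV (g v)) (tag u) (gsrc (tagged u))) ||
        (existT (fun v => gV (g v)) v y ==
           existT (fun v => gV (g v)) (tag u) (gtgt (tagged u)))))) /= ->.
by rewrite fm !eq_Tagged /= ![y == _]eq_sym.
Qed.

Section Decomposition.
Variables (R : comPzRingType) (G : cgraph).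
Variables (GB : forall b : Bv G, gadget R (NB b)) (GW : forall w : Wv G, gadget R (NW w)).
Hypothesis G_ok : cgraph_ok G.
Hypothesis GB_ok : forall b, gadget_ok (GB b).
Hypothesis GW_ok : forall w, gadget_ok (GW w).

Lemma ordB_uniq (b : Bv G) : uniq (ordB b).
Proof. by case: G_ok => _ [_ [_ [h _]]]; case: (h b). Qed.

Lemma ordW_uniq (w : Wv G) : uniq (ordW w).
Proof. by case: G_ok => _ [_ [_ [_ h]]]; case: (h w). Qed.

Lemma mem_ordB (b : Bv G) e : (e \in ordB b) = (eb e == b).
Proof. by case: G_ok => _ [_ [_ [h _]]]; case: (h b). Qed.

Lemma mem_ordW (w : Wv G) e : (e \in ordW w) = (ew e == w).
Proof. by case: G_ok => _ [_ [_ [_ h]]]; case: (h w). Qed.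

(** All blocks at a white vertex have size [nW w]; rewriting the size, and then the offset, as sums
    over edges gives the white side the same form as the black side. *)
Lemma NWE (w : Wv G) : NW w = (\sum_(e <- ordW w) nW (ew e))%N.
Proof.
rewrite big_seq (eq_bigr (fun => nW w)) => [|e]; last by rewrite mem_ordW => /eqP ->.
by rewrite -big_seq big_const_seq count_predT iter_addn_0 mulnC.
Qed.

Lemma offWE (e : Ed G) : offW e = offset (fun e' => nW (ew e')) (ordW (ew e)) e.
Proof.
rewrite /offW /offset big_seq [RHS]big_seq; apply: eq_bigr => e' /mem_take.
by rewrite mem_ordW => /eqP ->.
Qed.

Definition coveredB (A : forall e : Ed G, {set 'I_(nW (ew e))}) (b : Bv G) :=
  covered (@eb G) (@NB G) (@offB G) A b.
Definition coveredW (A : forall e : Ed G, {set 'I_(nW (ew e))}) (w : Wv G) :=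
  covered (@ew G) (@NW G) (@offW G) A w.

Local Notation unusedT := {dffun forall e : Ed G, {set 'I_(nW (ew e))}}.
Local Notation muBT := {dffun forall b : Bv G, {set gE (GB b)}}.
Local Notation muWT := {dffun forall w : Wv G, {set gE (GW w)}}.

Definition glue (q : unusedT * (muBT * muWT)) : {set hE GB GW} :=
  [set f | match f with
           | inl (inl bg) => tagged bg \in q.2.1 (tag bg)
           | inl (inr wg) => tagged wg \in q.2.2 (tag wg)
           | inr ek => tagged ek \notin q.1 (tag ek)
           end].

Definition cut (pi : {set hE GB GW}) : unusedT * (muBT * muWT) :=
  (finfun (fun e => [set k | (inr (existT (fun e => 'I_(nW (ew e))) e k) : hE GB GW) \notin pi]),
   (finfun (fun b => [set g | (inl (inl (existT (fun b => gE (GB b)) b g)) : hE GB GW) \in pi]),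
    finfun (fun w => [set g | (inl (inr (existT (fun w => gE (GW w)) w g)) : hE GB GW) \in pi]))).

Lemma glueK : cancel glue cut.
Proof.
case=> A [muB muW]; congr (_, (_, _)); apply/ffunP => x; rewrite ffunE;
  by apply/setP => k; rewrite !inE /= ?negbK.
Qed.

Lemma cutK : cancel cut glue.
Proof.
move=> pi; apply/setP; case=> [[[b g]|[w g]]|[e k]];
  by rewrite !inE /= ffunE inE ?negbK.
Qed.

Lemma weight_glue q :
  \prod_(f in glue q) hwt f =
  (\prod_b \prod_(g in q.2.1 b) gwt g) * (\prod_w \prod_(g in q.2.2 w) gwt g).
Proof.
rewrite !big_sumType /= [X in _ * X]big1 ?mulr1; last by [].
congr (_ * _).
  rewrite (sig_big_dep xpredT (fun b => [in q.2.1 b]) (fun b g => gwt g)) /=.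
  by apply: eq_big => [[b g]|[b g] _]; rewrite ?inE.
rewrite (sig_big_dep xpredT (fun w => [in q.2.2 w]) (fun w g => gwt g)) /=.
by apply: eq_big => [[w g]|[w g] _]; rewrite ?inE.
Qed.

Lemma dimer_at_black q b (y : gV (GB b)) :
  #|[set f in glue q | hinc f (inl (existT _ b y))]| =
  (#|[set g in q.2.1 b | ginc g y]| +
   #|[set ek : {e : Ed G & 'I_(nW (ew e))} | (tagged ek \notin q.1 (tag ek)) &&
        middle_touches (@eb G) (@offB G) ek (existT (fun b => gV (GB b)) b y)]|)%N.
Proof.
rewrite -card_incident_tagged -!sum1dep_card !big_sumType /=.
rewrite [X in (_ + X + _)%N]big1 ?addn0; last by case=> w g; rewrite andbC.
congr (_ + _)%N; apply: eq_bigl; first by case=> b' g; rewrite inE.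
case=> e k; rewrite inE /= /middle_touches /block_pos /=; congr (_ && _).
by case: (insub (offW e + k)%N) => [p|]; rewrite orbF.
Qed.

Lemma dimer_at_white q w (y : gV (GW w)) :
  #|[set f in glue q | hinc f (inr (existT _ w y))]| =
  (#|[set g in q.2.2 w | ginc g y]| +
   #|[set ek : {e : Ed G & 'I_(nW (ew e))} | (tagged ek \notin q.1 (tag ek)) &&
        middle_touches (@ew G) (@offW G) ek (existT (fun w => gV (GW w)) w y)]|)%N.
Proof.
rewrite -card_incident_tagged -!sum1dep_card !big_sumType /=.
rewrite [X in (X + _ + _)%N]big1 ?add0n; last by case=> b g; rewrite andbC.
congr (_ + _)%N; apply: eq_bigl; first by case=> w' g; rewrite inE.
case=> e k; rewrite inE /= /middle_touches /block_pos /=; congr (_ && _).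
by case: (insub (offB e + k)%N) => [p|].
Qed.

(** Once [q.1] is fixed, the middle edges contribute a known amount to each degree, so the
    degree-one condition decouples into one matching condition per gadget. *)
Lemma dimer_glue q :
  dimer (glue q) = [forall b, bmatching (coveredB q.1 b) (q.2.1 b)] &&
                   [forall w, bmatching (coveredW q.1 w) (q.2.2 w)].
Proof.
have hB b y : (#|[set f in glue q | hinc f (inl (existT _ b y))]| == 1%N) =
    (#|[set g in q.2.1 b | ginc g y]| ==
      (if [exists i, gbd (GB b) i == y]
       then (if [exists i in coveredB q.1 b, gbd (GB b) i == y] then 1 else 0)
       else 1)%N).
  rewrite dimer_at_black (boundary_condition ordB_uniq mem_ordB) //.
  by case: (GB_ok b).
have hW w y : (#|[set f in glue q | hinc f (inr (existT _ w y))]| == 1%N) =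
    (#|[set g in q.2.2 w | ginc g y]| ==
      (if [exists i, gbd (GW w) i == y]
       then (if [exists i in coveredW q.1 w, gbd (GW w) i == y] then 1 else 0)
       else 1)%N).
  rewrite dimer_at_white (boundary_condition ordW_uniq mem_ordW NWE offWE) //.
  by case: (GW_ok w).
apply/forallP/andP => [h|[/forallP h1 /forallP h2]].
  by split; apply/forallP => v; apply/forallP => y; rewrite -?hB -?hW.
case=> [[b y]|[w y]]; first by rewrite hB; apply: (forallP (h1 b)).
by rewrite hW; apply: (forallP (h2 w)).
Qed.

Lemma mpi_glue q e : Defs.mpi (glue q) e = #|q.1 e|.
Proof. by apply: eq_card => k; rewrite !inE /= negbK. Qed.

Lemma dimer_sum_gadgets m :
  dimer_sum GB GW m =
  \sum_(A : unusedT | [forall e, #|A e| == m e])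
     (\prod_b bsum (GB b) (coveredB A b)) * (\prod_w bsum (GW w) (coveredW A w)).
Proof.
rewrite /bsum; under [RHS]eq_bigr => A _.
  rewrite !bigA_distr_dffun big_distrlr pair_big /=. over.
rewrite pair_big_dep /= /dimer_sum (reindex glue); last first.
  by apply: onW_bij; exists cut; [apply: glueK | apply: cutK].
apply: eq_big => [q|q _]; last by rewrite weight_glue.
rewrite dimer_glue andbC; congr (_ && _).
by apply: eq_forallb => e; rewrite mpi_glue.
Qed.
End Decomposition.

(** * Colorings *)

Section ColorClasses.
Variables (E V : finType) (en : E -> V) (n : V -> nat) (ord : V -> seq E).
Hypothesis mem_ord : forall v e, (e \in ord v) = (en e == v).

Definition partitions (S : forall e, {set 'I_(n (en e))}) : bool :=
  [forall v, forall c : 'I_(n v),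
     #|[set e | (en e == v) && [exists x in S e, val x == val c]]| == 1%N].

(** This passes from one set per edge to one function per vertex, the form produced by the Laplace
    expansion. When [partitions S] holds, the pick is forced. *)
Definition coloring_of (S : forall e, {set 'I_(n (en e))}) v : {ffun 'I_(n v) -> option E} :=
  [ffun c => [pick e | (en e == v) && [exists x in S e, val x == val c]]].

Lemma eq_partitions S S' : (forall e, S e = S' e) -> partitions S = partitions S'.
Proof.
move=> eS; apply: eq_forallb => v; apply: eq_forallb => c; congr (_ == _).
by apply: eq_card => e; rewrite !inE eS.
Qed.

Lemma eq_coloring_of S S' v : (forall e, S e = S' e) -> coloring_of S v = coloring_of S' v.
Proof. by move=> eS; apply/ffunP => c; rewrite !ffunE; apply: eq_pick => e; rewrite /= eS. Qed.

Lemma color_class_coloring_of S e :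
  partitions S -> color_class (coloring_of S (en e)) e = S e.
Proof.
move=> /forallP /(_ (en e)) /forallP parts; apply/setP => c; rewrite inE ffunE.
have /cards1P[e0 he0] := parts c.
have he e1 : (en e1 == en e) && [exists x in S e1, val x == val c] = (e1 == e0).
  by have /setP/(_ e1) := he0; rewrite !inE.
rewrite -ranks_val mem_ranks.
have -> : [exists x in S e, val x == val c] = (e == e0) by rewrite -he eqxx.
case: pickP => [e1|none]; first by rewrite he => /eqP ->; rewrite eq_sym.
by have := none e0; rewrite he eqxx.
Qed.

Variable kappa : forall v, {ffun 'I_(n v) -> option E}.
Let S e := color_class (kappa (en e)) e.

Lemma mem_color_class_at v (c : 'I_(n v)) e :
  (en e == v) && [exists x in S e, val x == val c] =
  (en e == v) && (kappa v c == Some e).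
Proof.
case: eqP => //= ev; rewrite -mem_ranks; move: c; rewrite -ev => c.
by rewrite ranks_val inE.
Qed.

Lemma color_at v (c : 'I_(n v)) e m : has_profile m (ord v) (kappa v) ->
  (en e == v) && (kappa v c == Some e) = (kappa v c == Some e).
Proof.
case/andP=> /forallP /(_ c) /mapP[e0]; rewrite mem_ord => /eqP ev -> _.
by rewrite (inj_eq Some_inj) andbC; case: eqP => // <-; rewrite ev eqxx.
Qed.

(** Classes of a function are disjoint automatically; they fill the colors at [v] exactly when every
    label is an edge at [v]. *)
Lemma profiles_partitions m :
  [forall v, has_profile m (ord v) (kappa v)] =
  [forall e, #|S e| == m e] && partitions S.
Proof.
apply/forallP/andP => [h|[/forallP cS /forallP parts] v].
  split.
    apply/forallP => e; have /andP[_ /allP] := h (en e).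
    by apply; rewrite mem_ord.
  apply/forallP => v; apply/forallP => c.
  have /andP[/forallP /(_ c) /mapP[e0 _ ec] _] := h v.
  rewrite (_ : [set _ | _] = [set e0]) ?cards1 //; apply/setP => e.
  by rewrite !inE mem_color_class_at (color_at _ _ (h v)) ec (inj_eq Some_inj) eq_sym.
apply/andP; split.
  apply/forallP => c; have /forallP /(_ c) /cards1P[e0 /setP /(_ e0)] := parts v.
  rewrite !inE eqxx mem_color_class_at => /andP[ev /eqP ->].
  by rewrite (mem_map Some_inj) mem_ord.
by apply/allP => e; rewrite mem_ord => /eqP <-.
Qed.

Lemma coloring_of_color_class m v :
  has_profile m (ord v) (kappa v) -> coloring_of S v = kappa v.
Proof.
move=> pr; apply/ffunP => c; rewrite ffunE.
under eq_pick do rewrite mem_color_class_at (color_at _ _ pr).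
case: pickP => [e /eqP -> //|none].
have /andP[/forallP /(_ c) /mapP[e0 _ ec] _] := pr.
by have := none e0; rewrite ec eqxx.
Qed.
End ColorClasses.

(** * The trace as a sum over label functions at the vertices *)

Section Trace.
Variables (R : comPzRingType) (G : cgraph).
Hypothesis G_ok : cgraph_ok G.
Local Notation kapB := {dffun forall b : Bv G, {ffun 'I_(nB b) -> option (Ed G)}}.
Local Notation kapW := {dffun forall w : Wv G, {ffun 'I_(nW w) -> option (Ed G)}}.

Definition class_pair (q : kapB * kapW) : colT G :=
  finfun (fun e => (color_class (q.1 (eb e)) e, color_class (q.2 (ew e)) e)).

Definition coloring_pair (C : colT G) : kapB * kapW :=
  (finfun (coloring_of (en := @eb G) (fun e => (C e).1)),
   finfun (coloring_of (en := @ew G) (fun e => (C e).2))).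

Lemma coloringE m (C : colT G) :
  coloring m C =
  ([forall e, #|(C e).1| == m e] && partitions (en := @eb G) (fun e => (C e).1)) &&
  ([forall e, #|(C e).2| == m e] && partitions (en := @ew G) (fun e => (C e).2)).
Proof.
rewrite /coloring andbACA -andbA -/(partitions _) -/(partitions _); congr (_ && _).
apply/forallP/andP => [h|[/forallP h1 /forallP h2] e]; last by rewrite h1 h2.
by split; apply/forallP => e; case/andP: (h e).
Qed.

(** Colorings correspond to profiled label functions through the mutually inverse [class_pair] and
    [coloring_pair]; the signs [c_v] become the signs of the Laplace expansion. *)
Lemma trace_colorings (phi : connection R G) m :
  trace phi m =
  \sum_(q : kapB * kapW | [forall b, has_profile m (ordB b) (q.1 b)] &&
                          [forall w, has_profile m (ordW w) (q.2 w)])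
    (\prod_b seq_sign R (nB b) (flatten [seq ranks (color_class (q.1 b) e) | e <- ordB b])) *
    (\prod_w seq_sign R (nW w) (flatten [seq ranks (color_class (q.2 w) e) | e <- ordW w])) *
    \prod_e nat_minor (m e) (mxfun (phi e)) (ranks (color_class (q.2 (ew e)) e))
              (ranks (color_class (q.1 (eb e)) e)).
Proof.
have mB := mem_ordB G_ok; have mW := mem_ordW G_ok.
rewrite /trace (reindex_onto class_pair coloring_pair) /=; last first.
  move=> C; rewrite coloringE => /andP[/andP[_ pB] /andP[_ pW]].
  apply/ffunP => e; rewrite !ffunE /= !color_class_coloring_of //.
  by case: (C e).
have CE q e : class_pair q e = (color_class (q.1 (eb e)) e, color_class (q.2 (ew e)) e).
  by rewrite ffunE.
(* The round trip fixes profiled pairs, so the condition left by the reindexing is just the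
   profiles. *)
have pE q : coloring m (class_pair q) && (coloring_pair (class_pair q) == q) =
    [forall b, has_profile m (ordB b) (q.1 b)] &&
    [forall w, has_profile m (ordW w) (q.2 w)].
  have pB : [forall b, has_profile m (ordB b) (q.1 b)] =
      [forall e, #|(class_pair q e).1| == m e] &&
      partitions (en := @eb G) (fun e => (class_pair q e).1).
    rewrite (profiles_partitions mB q.1); congr (_ && _).
      by apply: eq_forallb => e; rewrite CE.
    by apply: eq_partitions => e; rewrite CE.
  have pW : [forall w, has_profile m (ordW w) (q.2 w)] =
      [forall e, #|(class_pair q e).2| == m e] &&
      partitions (en := @ew G) (fun e => (class_pair q e).2).
    rewrite (profiles_partitions mW q.2); congr (_ && _).
      by apply: eq_forallb => e; rewrite CE.
    by apply: eq_partitions => e; rewrite CE.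
  rewrite coloringE -pB -pW andb_idr // => /andP[/forallP hB /forallP hW]; apply/eqP.
  rewrite [RHS]surjective_pairing; congr (_, _); apply/ffunP => v; rewrite ffunE.
    rewrite -(coloring_of_color_class mB (hB v)); apply: eq_coloring_of => e.
    by rewrite CE.
  rewrite -(coloring_of_color_class mW (hW v)); apply: eq_coloring_of => e.
  by rewrite CE.
rewrite (eq_bigl _ _ pE); apply: eq_bigr => q; rewrite -pE => /andP[].
rewrite coloringE => /andP[/andP[/forallP cB _] /andP[/forallP cW _]] _.
congr (_ * _ * _).
- apply: eq_bigr => b _; congr (seq_sign _ _ (flatten _)).
  by apply/eq_in_map => e; rewrite mB => /eqP <-; rewrite CE.
- apply: eq_bigr => w _; congr (seq_sign _ _ (flatten _)).
  by apply/eq_in_map => e; rewrite mW => /eqP <-; rewrite CE.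
(* Edges with [m e = 0] may join the product, since an empty minor is 1. *)
rewrite big_mkcond; apply: eq_bigr => e _.
case: posnP => [m0|_]; first by rewrite /nat_minor m0 det_mx00.
by rewrite minorE ?(eqP (cB e)) ?(eqP (cW e)) // CE.
Qed.
End Trace.

(** * Assembly of the vertex expansions edge by edge *)

Theorem theorem5 (R : realFieldType) (G : cgraph) (phi : connection R G)
    (GB : forall b : Bv G, gadget R (NB b)) (GW : forall w : Wv G, gadget R (NW w))
    (MB : forall b : Bv G, 'M[R]_(NB b, nB b)) (MW : forall w : Wv G, 'M[R]_(nW w, NW w)) :
  cgraph_ok G ->
  (forall b, gadget_ok (GB b)) -> (forall w, gadget_ok (GW w)) ->
  (forall e : Ed G, phi e = blkW MW e *m blkB MB e) ->
  (forall (b : Bv G) (I : {set 'I_(NB b)}),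
      #|I| = nB b -> bsum (GB b) I = minor (nB b) (MB b) I setT) ->
  (forall (w : Wv G) (J : {set 'I_(NW w)}),
      #|J| = nW w -> bsum (GW w) J = minor (nW w) (MW w) setT J) ->
  forall m : Ed G -> nat, multiweb m ->
    dimer_sum GB GW m = trace phi m.
Proof.
move=> okG okB okW hphi hB hW m [mwB mwW].
have uB := ordB_uniq okG; have uW := ordW_uniq okG.
have mB := mem_ordB okG; have mW := mem_ordW okG.
have nwE := NWE okG; have ofE := offWE okG.
rewrite (dimer_sum_gadgets okG okB okW) (trace_colorings okG).
(* [sB] and [sW] are the vertex signs; [uuB] and [uuW] are the minors of [blkB MB e] and [blkW MW e]
   that an edge receives from its two ends. *)
pose sB b (k : {ffun 'I_(nB b) -> option (Ed G)}) :=
  seq_sign R (nB b) (flatten [seq ranks (color_class k e) | e <- ordB b]).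
pose sW w (k : {ffun 'I_(nW w) -> option (Ed G)}) :=
  seq_sign R (nW w) (flatten [seq ranks (color_class k e) | e <- ordW w]).
pose uuB e (A : {set 'I_(nW (ew e))}) (k : {ffun 'I_(nB (eb e)) -> option (Ed G)}) :=
  nat_minor (m e) (mxfun (blkB MB e)) (ranks A) (ranks (color_class k e)).
pose uuW e (A : {set 'I_(nW (ew e))}) (k : {ffun 'I_(nW (ew e)) -> option (Ed G)}) :=
  nat_minor (m e) (mxfun (blkW MW e)) (ranks (color_class k e)) (ranks A).
have LB (A : {dffun forall e : Ed G, {set 'I_(nW (ew e))}}) : [forall e, #|A e| == m e] ->
    \prod_b bsum (GB b) (coveredB A b) =
    \sum_(k : {dffun forall b : Bv G, {ffun 'I_(nB b) -> option (Ed G)}} |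
           [forall b, has_profile m (ordB b) (k b)])
       (\prod_b sB b (k b)) * \prod_e uuB e (A e) (k (eb e)).
  move=> /forallP cA'; have cA e := eqP (cA' e).
  transitivity (\prod_b \sum_(k : {ffun 'I_(nB b) -> option (Ed G)} | has_profile m (ordB b) k)
     sB b k * \prod_(e <- ordB b) nat_minor (m e) (mxfun (blkB MB e)) (ranks (A e))
        (ranks (color_class k e))).
    apply: eq_bigr => b _; rewrite hB.
      exact: (vertex_expansion (off := @offB G) uB mB).
    (* The multiweb condition at [b] gives the covered set size [nB b], as the hypothesis on gadget
       sums requires. *)
    rewrite (card_covered uB mB) // -mwB -(sum_ord uB mB).
    by apply: eq_bigr => e _.
  rewrite bigA_distr_dffun; apply: eq_bigr => k _; rewrite big_split /=; congr (_ * _).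
  rewrite -(prod_ord uB mB); apply: eq_bigr => b _; rewrite !big_seq.
  by apply: eq_bigr => e; rewrite mB => /eqP <-.
have LW (A : {dffun forall e : Ed G, {set 'I_(nW (ew e))}}) : [forall e, #|A e| == m e] ->
    \prod_w bsum (GW w) (coveredW A w) =
    \sum_(k : {dffun forall w : Wv G, {ffun 'I_(nW w) -> option (Ed G)}} |
           [forall w, has_profile m (ordW w) (k w)])
       (\prod_w sW w (k w)) * \prod_e uuW e (A e) (k (ew e)).
  move=> /forallP cA'; have cA e := eqP (cA' e).
  (* White minors select columns; transposing turns them into row selections, to which
     [vertex_expansion] applies. *)
  have blkWE e : blkW MW e =
      (row_block (@ew G) (fun e => nW (ew e)) (@offW G) (fun w => (MW w)^T) e)^T.
    by apply/matrixP => i j; rewrite !mxE /block_pos; case: insub => // p; rewrite mxE.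
  transitivity (\prod_w \sum_(k : {ffun 'I_(nW w) -> option (Ed G)} | has_profile m (ordW w) k)
     sW w k * \prod_(e <- ordW w) nat_minor (m e) (mxfun (blkW MW e))
        (ranks (color_class k e)) (ranks (A e))).
    apply: eq_bigr => w _; rewrite hW.
      rewrite minor_tr (vertex_expansion (n := @nW G) uW mW nwE ofE (fun w => (MW w)^T) w mwW cA).
      apply: eq_bigr => k _; congr (_ * _); apply: eq_bigr => e _.
      rewrite nat_minor_tr; congr (\det _); apply/matrixP => i j.
      by rewrite !mxE blkWE mxfun_tr.
    rewrite (card_covered uW mW) // -mwW -(sum_ord uW mW).
    by apply: eq_bigr => e _.
  rewrite bigA_distr_dffun; apply: eq_bigr => k _; rewrite big_split /=; congr (_ * _).
  rewrite -(prod_ord uW mW); apply: eq_bigr => w _; rewrite !big_seq.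
  by apply: eq_bigr => e; rewrite mW => /eqP <-.
under eq_bigr => A cA do rewrite (LB A cA) (LW A cA) big_distrlr pair_big /=.
(* With the label functions [q] outermost, the signs do not depend on [A] and come out of the inner
   sum. *)
rewrite exchange_big /=; apply: eq_bigr => q _.
under eq_bigr => A _ do rewrite mulrACA -big_split /=.
rewrite -big_distrr /=; congr (_ * _).
(* The sum over [A] factors into independent sums over subsets [A e], each of them the Cauchy-Binet
   expansion of one minor of [phi e]. *)
rewrite -(bigA_distr_dffun (fun e (A : {set 'I_(nW (ew e))}) => #|A| == m e)
  (fun e A => uuB e A (q.1 (eb e)) * uuW e A (q.2 (ew e)))).
apply: eq_bigr => e _; rewrite hphi nat_minor_mulmx.
by apply: eq_bigr => A _; rewrite mulrC.
Qed.
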